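(* Non-congruent meshes may have identical $k$-point $\mathbb{G}$-curvatures. That is, for each of the groups $\mathbb{G}\in\{S\mathbb{E}(2),\mathbb{E}(2),S\mathbb{A}(2),\bar{\mathbb{A}}(2)\}$ acting on $\mathbb{R}^2$ there exist two ordinary meshes $\gamma^{\vartriangle}=\{p_i\}$ and $\tilde\gamma^{\vartriangle}=\{\tilde p_i\}$ with the same number of points (convex meshes in the two affine cases) which have the same $k$-point $\mathbb{G}$-curvature, i.e. $\kappa^{\vartriangle}_{\mathbb{G}}(\tilde p_i)=\kappa^{\vartriangle}_{\mathbb{G}}(p_i)$ at all points where the curvature is defined, but which are not $\mathbb{G}$-congruent. Here $k=2$ and $\kappa^{\vartriangle}_{\mathbb{G}}=\kappa^{\vartriangle}_{\mathbb{E}}$ in the two Euclidean cases, and $k=3$ and $\kappa^{\vartriangle}_{\mathbb{G}}=\kappa^{\vartriangle}_{\mathbb{A}}$ in the two affine cases.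
   Context: Groups: $S\mathbb{E}(2)=SO(2)\ltimes\mathbb{R}^2$, $\mathbb{E}(2)=O(2)\ltimes\mathbb{R}^2$, $S\mathbb{A}(2)=SL(2)\ltimes\mathbb{R}^2$, and $\bar{\mathbb{A}}(2)$ is $S\mathbb{A}(2)$ extended by reflections. A mesh is a finite list of successive points $p_1,\dots,p_n\in\mathbb{R}^2$ (consecutive points distinct). It is ordinary if it has no cusp, i.e. there is no $i$ with $p_{i+1}=p_{i-1}$. It is convex if no three of its points are collinear. Two $n$-point meshes are $\mathbb{G}$-congruent if there is $g\in\mathbb{G}$ with $\tilde p_i=g\cdot p_i$ for all $1\le i\le n$. The $m$-neighborhood of $p_i$ consists of $p_{i-m},\dots,p_i,\dots,p_{i+m}$. 2-point Euclidean curvature (meshes with at least 3 points): $\kappa^{\vartriangle}_{\mathbb{E}}(p_i)=\frac{4\Delta}{abc}(p_i)$, where $a\ge b\ge c$ are the side lengths and $\Delta$ the area of the triangle $p_{i-1},p_i,p_{i+1}$ (the reciprocal of the circumradius). 3-point affine curvature (convex meshes with at least 5 points): let $Ax^2+2Bxy+Cy^2+2Dx+2Ey+G=0$ be the conic through the five points of the two-neighborhood of $p_i$. Put $S=AC-B^2$ and let $F$ be the determinant of the symmetric matrix $\begin{pmatrix} A & B & D \\ B & C & E \\ D & E & G \end{pmatrix}$. Then $\kappa^{\vartriangle}_{\mathbb{A}}(p_i)=\frac{S}{F^{2/3}}(p_i)$. *)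

(* Defs.v *)
From mathcomp Require Import all_boot all_order all_algebra.
From mathcomp Require Import all_classical all_reals all_analysis.

Set Implicit Arguments.
Unset Strict Implicit.
Unset Printing Implicit Defensive.

Import Order.TTheory GRing.Theory Num.Theory.

Local Open Scope classical_set_scope.
Local Open Scope ring_scope.

(* S𝔼(2), 𝔼(2), S𝔸(2) and 𝔸̄(2). *)
Inductive plane_group := SE2 | E2 | SA2 | A2bar.

Definition is_affine (G : plane_group) : bool :=
  match G with SE2 | E2 => false | SA2 | A2bar => true end.

Section Meshes.
Variable R : realType.

Notation point := 'cV[R]_2.
Notation mesh := (seq 'cV[R]_2).

Definition xcoord (p : point) : R := p 0 0.
Definition ycoord (p : point) : R := p 1 0.

(* Each group is the semidirect product of this linear group with R^2.
   Every reflection has determinant -1, so adjoining reflections to SL(2)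
   gives exactly the matrices of determinant 1 or -1. *)
Definition linear_part (G : plane_group) : set 'M[R]_2 :=
  match G with
  | SE2 => [set M | M *m M^T = 1%:M /\ \det M = 1]
  | E2 => [set M | M *m M^T = 1%:M]
  | SA2 => [set M | \det M = 1]
  | A2bar => [set M | \det M = 1 \/ \det M = -1]
  end.

(* Lists are indexed from 0: p`_i is the point written p_(i+1) when points
   are numbered from 1. *)
Definition is_mesh (p : mesh) : Prop :=
  forall i, (i.+1 < size p)%N -> p`_i.+1 != p`_i.

Definition ordinary (p : mesh) : Prop :=
  forall i, (0 < i)%N -> (i.+1 < size p)%N -> p`_i.+1 != p`_i.-1.

Definition collinear (x y z : point) : Prop :=
  exists o v : point, v != 0 /\
    forall w, w \in [:: x; y; z] -> exists t : R, w = o + t *: v.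

(* The three points are taken at distinct positions of the list; in
   particular the points of a convex mesh with at least three points are
   pairwise distinct. *)
Definition convex_mesh (p : mesh) : Prop :=
  forall i j k, (i < j)%N -> (j < k)%N -> (k < size p)%N ->
    ~ collinear p`_i p`_j p`_k.

Definition congruent (G : plane_group) (p q : mesh) : Prop :=
  size p = size q /\
  exists (M : 'M[R]_2) (v : point), linear_part G M /\
    forall i, (i < size p)%N -> q`_i = M *m p`_i + v.

Definition neighborhood (m : nat) (p : mesh) (i : nat) : seq point :=
  [seq p`_j | j <- iota (i - m) m.*2.+1].

(* The Euclidean distance; the library norm on matrices is the sup norm. *)
Definition dist (x y : point) : R :=
  Num.sqrt ((xcoord x - xcoord y) ^+ 2 + (ycoord x - ycoord y) ^+ 2).

Definition area (x y z : point) : R :=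
  `|(xcoord y - xcoord x) * (ycoord z - ycoord x)
    - (xcoord z - xcoord x) * (ycoord y - ycoord x)| / 2.

Definition euclidean_curvature (p : mesh) (i : nat) : R :=
  let x := p`_i.-1 in let y := p`_i in let z := p`_i.+1 in
  4 * area x y z / (dist x y * dist y z * dist x z).

Record conic := Conic { cA : R; cB : R; cC : R; cD : R; cE : R; cG : R }.

Definition is_conic (Q : conic) : Prop :=
  ~ [/\ cA Q = 0, cB Q = 0 & cC Q = 0].

Definition on_conic (Q : conic) (p : point) : Prop :=
  let x := xcoord p in let y := ycoord p in
  cA Q * x ^+ 2 + 2 * cB Q * x * y + cC Q * y ^+ 2
  + 2 * cD Q * x + 2 * cE Q * y + cG Q = 0.

Definition conic_S (Q : conic) : R := cA Q * cC Q - cB Q ^+ 2.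

Definition conic_mx (Q : conic) : 'M[R]_3 :=
  \matrix_(i < 3, j < 3)
    (nth [::] [:: [:: cA Q; cB Q; cD Q];
                  [:: cB Q; cC Q; cE Q];
                  [:: cD Q; cE Q; cG Q]] i)`_j.

Definition conic_F (Q : conic) : R := \det (conic_mx Q).

(* F may be negative, and F^(2/3), the square of the real cube root of F, is
   then |F|^(2/3). *)
Definition conic_curvature (Q : conic) : R :=
  conic_S Q / (`|conic_F Q| `^ (2 / 3)).

(* Five points no three of which are collinear lie on a unique conic, whose
   coefficients are determined up to a common nonzero factor c; S and F^(2/3)
   are both multiplied by c^2, so for a convex mesh the set below is a
   singleton. *)
Definition affine_curvature (p : mesh) (i : nat) : R :=
  xget 0 [set kappa | exists Q : conic, [/\ is_conic Q,
    forall x, x \in neighborhood 2 p i -> on_conic Q x &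
    kappa = conic_curvature Q]].

Definition curvature (G : plane_group) : mesh -> nat -> R :=
  if is_affine G then affine_curvature else euclidean_curvature.

(* The curvature at p_i depends on the m-neighborhood of p_i with m = k - 1,
   where k = 2 in the Euclidean cases and k = 3 in the affine ones. *)
Definition nbhd_radius (G : plane_group) : nat := if is_affine G then 2 else 1.

(* The m-neighborhood of p_i lies within the mesh. *)
Definition curvature_defined (G : plane_group) (p : mesh) (i : nat) : Prop :=
  (nbhd_radius G <= i)%N /\ (i + nbhd_radius G < size p)%N.

End Meshes.

(* Main.v *)
Require Import Defs.
From mathcomp Require Import all_boot all_order all_algebra.
From mathcomp Require Import all_classical all_reals all_analysis.
From mathcomp Require Import ring lra zify.

(** Both curvatures are constant on the circle: the circumcircle of any three
    points of the unit circle, and the conic through any five of them, is the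
    unit circle itself, whatever the points are.  So any two meshes inscribed
    in the unit circle have the same curvature, equal to 1 in the Euclidean as
    in the affine case, and one only has to choose two of them that are not
    congruent.  All four groups preserve the area of triangles, so it suffices
    that the first three points of the two meshes span triangles of different
    areas; one pair of five-point meshes then serves all the groups.

    The rational parametrization of the circle by the slope [t] makes this
    polynomial algebra.  Up to nonzero factors depending on one parameter each,
    the signed area of an inscribed triangle is the product of the differences
    of its parameters ([signed_area2_circle_point]), and the length of a chord
    is the distance between its two parameters ([dist_circle_point]).  This
    gives the Euclidean curvature, and shows that no three distinct points of
    the circle are collinear.
    A conic restricts to a polynomial of degree at most 4 in [t]; if it passes
    through five points of the circle this polynomial vanishes identically,
    which forces the conic to be a multiple of the circle
    ([conic_through_circle_points]). *)

Set Implicit Arguments.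
Unset Strict Implicit.
Unset Printing Implicit Defensive.

Import Order.TTheory GRing.Theory Num.Theory.

Local Open Scope ring_scope.

Section CircleMeshes.
Variable R : realType.
Implicit Types (a b c t : R) (s : seq R) (x y z v : 'cV[R]_2)
  (Q : conic R).

(** The second intersection of the unit circle with the line of slope [t]
    through (-1, 0); every point of the circle but (-1, 0) is reached. *)
Definition circle_point t : 'cV[R]_2 :=
  \col_(i < 2) if i == 0 then (1 - t ^+ 2) / (1 + t ^+ 2)
               else 2 * t / (1 + t ^+ 2).

Definition circle_mesh s : seq 'cV[R]_2 := map circle_point s.

Definition signed_area2 x y z : R :=
  (xcoord y - xcoord x) * (ycoord z - ycoord x)
  - (xcoord z - xcoord x) * (ycoord y - ycoord x).

Lemma sqr1D_gt0 t : 0 < 1 + t ^+ 2.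
Proof. by rewrite ltr_pwDl ?ltr01 ?sqr_ge0. Qed.

Lemma sqr1D_neq0 t : 1 + t ^+ 2 != 0.
Proof. by rewrite gt_eqF ?sqr1D_gt0. Qed.

Lemma xcoord_circle_point t :
  xcoord (circle_point t) = (1 - t ^+ 2) / (1 + t ^+ 2).
Proof. by rewrite /xcoord mxE. Qed.

Lemma ycoord_circle_point t :
  ycoord (circle_point t) = 2 * t / (1 + t ^+ 2).
Proof. by rewrite /ycoord mxE. Qed.

Definition coord_circle_point := (xcoord_circle_point, ycoord_circle_point).

Lemma nth_circle_mesh s i : (i < size s)%N ->
  (circle_mesh s)`_i = circle_point s`_i.
Proof. by move=> lt_i_s; rewrite (nth_map 0). Qed.

(** * Triangles inscribed in the circle *)

Lemma signed_area2_circle_point a b c :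
  signed_area2 (circle_point a) (circle_point b) (circle_point c) =
  4 * ((b - a) * (c - b) * (c - a))
  / ((1 + a ^+ 2) * (1 + b ^+ 2) * (1 + c ^+ 2)).
Proof.
rewrite /signed_area2 !coord_circle_point.
by field; rewrite !sqr1D_neq0.
Qed.

Lemma dist_circle_point a b :
  dist (circle_point a) (circle_point b) =
  2 * `|b - a| / (Num.sqrt (1 + a ^+ 2) * Num.sqrt (1 + b ^+ 2)).
Proof.
have wge0 t : 0 <= 1 + t ^+ 2 := ltW (sqr1D_gt0 t).
rewrite -sqrtrM // -[RHS]ger0_norm; last first.
  by rewrite divr_ge0 ?sqrtr_ge0 ?mulr_ge0.
rewrite -sqrtr_sqr /dist !coord_circle_point; congr (Num.sqrt _).
rewrite expr_div_n exprMn real_normK ?num_real // sqr_sqrtr ?mulr_ge0 //.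
by field; rewrite !sqr1D_neq0.
Qed.

Lemma collinear_signed_area2 x y z : collinear x y z -> signed_area2 x y z = 0.
Proof.
move=> [q [v [_ on_line]]].
have [] := on_line x; first by rewrite !inE eqxx.
move=> tx ->.
have [] := on_line y; first by rewrite !inE eqxx orbT.
move=> ty ->.
have [] := on_line z; first by rewrite !inE eqxx !orbT.
move=> tz ->.
by rewrite /signed_area2 /xcoord /ycoord !mxE; ring.
Qed.

Lemma circle_point_inj : injective circle_point.
Proof.
move=> a b ab; apply/eqP/negPn/negP => neq_ab.
have: dist (circle_point a) (circle_point b) = 0.
  by rewrite ab /dist !subrr expr0n addr0 sqrtr0.
rewrite dist_circle_point => /eqP; apply/negP.
have w_neq0 t : Num.sqrt (1 + t ^+ 2) != 0 by rewrite gt_eqF ?sqrtr_gt0 ?sqr1D_gt0.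
by rewrite !mulf_neq0 ?invr_neq0 ?mulf_neq0 ?normr_eq0 ?subr_eq0 // 1?eq_sym.
Qed.

Lemma convex_circle_mesh s : uniq s -> convex_mesh (circle_mesh s).
Proof.
move=> s_uniq i j k ij jk; rewrite size_map => ks.
have js := ltn_trans jk ks; have is_ := ltn_trans ij js.
rewrite !nth_circle_mesh // => /collinear_signed_area2/eqP.
rewrite signed_area2_circle_point; apply/negP.
rewrite !mulf_neq0 ?invr_neq0 ?mulf_neq0 ?sqr1D_neq0 ?pnatr_eq0 //.
- by rewrite subr_eq0 nth_uniq // gtn_eqF.
- by rewrite subr_eq0 nth_uniq // gtn_eqF.
- by rewrite subr_eq0 nth_uniq // gtn_eqF // (ltn_trans ij).
Qed.

Lemma mesh_circle_mesh s : uniq s -> is_mesh (circle_mesh s).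
Proof.
move=> s_uniq i; rewrite size_map => lt_i_s.
rewrite !nth_circle_mesh ?(ltnW lt_i_s) // (inj_eq circle_point_inj).
by rewrite nth_uniq ?(ltnW lt_i_s) // gtn_eqF.
Qed.

Lemma ordinary_circle_mesh s : uniq s -> ordinary (circle_mesh s).
Proof.
move=> s_uniq [//|i] _; rewrite size_map /= => lt_i_s.
have lt_i_s' : (i < size s)%N by exact: ltn_trans (ltnW lt_i_s).
rewrite !nth_circle_mesh // (inj_eq circle_point_inj).
by rewrite nth_uniq // gtn_eqF.
Qed.

(** The differences of parameters cancel between the area and the sides,
    and so do the factors [1 + t ^+ 2], each vertex lying on two sides. *)
Lemma euclidean_curvature_circle_mesh s i :
  uniq s -> (0 < i)%N -> (i.+1 < size s)%N ->
  euclidean_curvature (circle_mesh s) i = 1.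
Proof.
case: i => [//|i] s_uniq _ lt2; rewrite /euclidean_curvature /=.
have lt1 := ltnW lt2; have lt0 := ltnW lt1.
rewrite !nth_circle_mesh // !dist_circle_point.
rewrite /area -/(signed_area2 _ _ _) signed_area2_circle_point.
have: `|s`_i.+1 - s`_i| != 0 by rewrite normr_eq0 subr_eq0 nth_uniq // gtn_eqF.
have: `|s`_i.+2 - s`_i.+1| != 0 by rewrite normr_eq0 subr_eq0 nth_uniq // gtn_eqF.
have: `|s`_i.+2 - s`_i| != 0 by rewrite normr_eq0 subr_eq0 nth_uniq // gtn_eqF.
move: s`_i s`_i.+1 s`_i.+2 => a b c ca cb ba.
pose w t := Num.sqrt (1 + t ^+ 2); rewrite -!/(w _).
have w_neq0 t : w t != 0 by rewrite gt_eqF ?sqrtr_gt0 ?sqr1D_gt0.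
have wK t : 1 + t ^+ 2 = w t ^+ 2 by rewrite sqr_sqrtr ?ltW ?sqr1D_gt0.
rewrite !normrM normfV !normrM !normr_nat.
rewrite !(ger0_norm (ltW (sqr1D_gt0 _))) !wK.
by field; rewrite ca cb ba !w_neq0.
Qed.

(** * Conics through five points of the circle *)

(** The equation of the conic [Q] at [circle_point t], multiplied by
    [(1 + t ^+ 2) ^+ 2]. *)
Definition conic_on_circle (Q : conic R) : {poly R} :=
  Poly [:: cA Q + 2 * cD Q + cG Q; 4 * (cB Q + cE Q);
           2 * (cG Q - cA Q) + 4 * cC Q; 4 * (cE Q - cB Q);
           cA Q - 2 * cD Q + cG Q].

Lemma root_conic_on_circle Q t :
  on_conic Q (circle_point t) -> root (conic_on_circle Q) t.
Proof.
rewrite /on_conic !coord_circle_point => Qt.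
apply/rootP; rewrite horner_Poly /=.
rewrite -[RHS](mulr0 ((1 + t ^+ 2) ^+ 2)) -[in RHS]Qt.
by field; rewrite sqr1D_neq0.
Qed.

(** A special case of Bezout's theorem: the restriction of the conic to the
    circle is a polynomial of degree at most 4, so five roots kill all its
    coefficients, and these determine the conic up to a factor. *)
Lemma conic_through_circle_points Q s :
  uniq s -> (4 < size s)%N ->
  {in s, forall t, on_conic Q (circle_point t)} ->
  [/\ cC Q = cA Q, cG Q = - cA Q, cB Q = 0, cD Q = 0 & cE Q = 0].
Proof.
move=> s_uniq s_gt4 Qs.
have P0 : conic_on_circle Q = 0.
  apply/eqP/negPn/negP => P_neq0.
  have s_roots : all (root (conic_on_circle Q)) s.
    by apply/allP => t /Qs; exact: root_conic_on_circle.
  have := max_poly_roots P_neq0 s_roots s_uniq.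
  rewrite ltnNge => /negP; apply.
  apply: leq_trans s_gt4; exact: size_Poly.
have coefP k : (conic_on_circle Q)`_k = 0 by rewrite P0 coef0.
move: (coefP 0) (coefP 1) (coefP 2) (coefP 3) (coefP 4).
rewrite !coef_Poly /= => h0 h1 h2 h3 h4.
by split; lra.
Qed.

Lemma conic_F_circle Q :
  cC Q = cA Q -> cG Q = - cA Q -> cB Q = 0 -> cD Q = 0 -> cE Q = 0 ->
  conic_F Q = - cA Q ^+ 3.
Proof.
move=> eC eG eB eD eE.
pose d : 'rV[R]_3 := \row_(i < 3) [:: cA Q; cA Q; - cA Q]`_i.
have mxE_circle : conic_mx Q = diag_mx d.
  apply/matrixP => i j; rewrite !mxE eC eG eB eD eE.
  by case: i => -[|[|[|//]]] ?; case: j => -[|[|[|//]]] ?.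
by rewrite /conic_F mxE_circle det_diag !big_ord_recr big_ord0 /= !mxE /=; ring.
Qed.

(** Here [S = A ^+ 2] and [F = - A ^+ 3], so the factor [A] cancels. *)
Lemma conic_curvature_circle Q :
  cC Q = cA Q -> cG Q = - cA Q -> cB Q = 0 -> cD Q = 0 -> cE Q = 0 ->
  cA Q != 0 -> conic_curvature Q = 1.
Proof.
move=> eC eG eB eD eE A_neq0.
rewrite /conic_curvature conic_F_circle // normrN normrX.
rewrite -powR_mulrn // -powRrM mulrCA divff ?pnatr_eq0 // mulr1.
rewrite powR_mulrn // real_normK ?num_real //.
by rewrite /conic_S eC eB expr0n subr0 -expr2 divff // expf_neq0.
Qed.

Lemma affine_curvature_circle_mesh s i :
  uniq s -> (1 < i)%N -> (i.+2 < size s)%N ->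
  affine_curvature (circle_mesh s) i = 1.
Proof.
move=> s_uniq lt1i lt_i_s.
have ge5 : (5 <= size s - (i - 2))%N by move: lt1i lt_i_s; clear; lia.
pose s5 := take 5 (drop (i - 2) s).
have s5_size : size s5 = 5 by rewrite size_takel // size_drop.
have s5_uniq : uniq s5 by rewrite take_uniq ?drop_uniq.
have nbhdE : neighborhood 2 (circle_mesh s) i = circle_mesh s5.
  by rewrite /neighborhood map_nth_iota ?size_map // -map_drop -map_take.
rewrite /affine_curvature nbhdE; apply: xget_unique => [|_ [Q [Q_conic Qs5 ->]]].
(* The circle itself is a conic through the five points. *)
- exists (Conic 1 0 1 0 0 (-1)); split=> [[/eqP]||].
  + by rewrite oner_eq0.
  + move=> _ /mapP [t _ ->]; rewrite /on_conic !coord_circle_point /=.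
    by field; rewrite sqr1D_neq0.
  + by rewrite conic_curvature_circle ?oner_eq0.
- have [//||t ts5|eC eG eB eD eE] := @conic_through_circle_points Q s5.
  + by rewrite s5_size.
  + exact/Qs5/map_f.
  apply: conic_curvature_circle => //.
  apply/eqP => A0; apply: Q_conic.
  by rewrite eC eB A0.
Qed.

Lemma curvature_circle_mesh G s i :
  uniq s -> curvature_defined G (circle_mesh s) i ->
  curvature G (circle_mesh s) i = 1.
Proof.
move=> s_uniq []; rewrite /curvature /nbhd_radius size_map.
case: is_affine => lo hi.
- by apply: affine_curvature_circle_mesh => //; rewrite -addn2.
- by apply: euclidean_curvature_circle_mesh => //; rewrite -addn1.
Qed.

(** * Invariance of the area *)

Lemma linear_part_sqr_det G (M : 'M[R]_2) : linear_part G M -> \det M ^+ 2 = 1.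
Proof.
have orth_det : M *m M^T = 1%:M -> \det M ^+ 2 = 1.
  by move=> MMT; rewrite expr2 -[X in _ * X]det_tr -det_mulmx MMT det1.
case: G => /=.
- by move=> [/orth_det].
- exact: orth_det.
- by move=> ->; rewrite expr1n.
- by move=> [] ->; rewrite ?sqrrN expr1n.
Qed.

Lemma det_mx22 (M : 'M[R]_2) : \det M = M 0 0 * M 1 1 - M 0 1 * M 1 0.
Proof.
rewrite (expand_det_row _ 0) !big_ord_recl big_ord0 addr0 /cofactor !det_mx11.
rewrite !mxE /= expr0 expr1 mul1r mulN1r mulrN.
by congr (_ * M _ _ - M _ _ * M _ _); exact/val_inj.
Qed.

Lemma signed_area2_affine (M : 'M[R]_2) v x y z :
  signed_area2 (M *m x + v) (M *m y + v) (M *m z + v)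
  = \det M * signed_area2 x y z.
Proof.
have mulE i u : (M *m u + v) i 0 = M i 0 * u 0 0 + M i 1 * u 1 0 + v i 0.
  rewrite !mxE !big_ord_recl big_ord0 addr0.
  by congr (_ + M _ _ * u _ _ + _); exact/val_inj.
by rewrite /signed_area2 /xcoord /ycoord !mulE det_mx22; ring.
Qed.

(** Squaring absorbs the determinant -1 of the reflections, so that one
    invariant serves the four groups. *)
Lemma congruent_sqr_area G (p q : seq 'cV[R]_2) i j k :
  congruent G p q -> (i < size p)%N -> (j < size p)%N -> (k < size p)%N ->
  signed_area2 q`_i q`_j q`_k ^+ 2 = signed_area2 p`_i p`_j p`_k ^+ 2.
Proof.
move=> [_ [M [v [GM qE]]]] ip jp kp.
by rewrite !qE // signed_area2_affine exprMn (linear_part_sqr_det GM) mul1r.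
Qed.

End CircleMeshes.

Theorem proposition3p1 (R : realType) (G : plane_group) :
  exists p q : seq 'cV[R]_2,
    size p = size q /\
    ((nbhd_radius G).*2.+1 <= size p)%N /\
    is_mesh p /\ is_mesh q /\
    ordinary p /\ ordinary q /\
    (is_affine G -> convex_mesh p /\ convex_mesh q) /\
    (forall i : nat, curvature_defined G p i ->
       curvature G q i = curvature G p i) /\
    ~ congruent G p q.
Proof.
(* The parameters increase, so both meshes run counterclockwise on the circle;
   their first three points span triangles of areas 2/5 and 3/5. *)
pose s : seq R := [seq n%:R | n <- [:: 0; 1; 2; 3; 4]%N].
pose s' : seq R := [seq n%:R | n <- [:: 0; 1; 3; 4; 5]%N].
have s_uniq : uniq s by rewrite map_inj_uniq //; exact: mulrIn (oner_neq0 _).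
have s'_uniq : uniq s' by rewrite map_inj_uniq //; exact: mulrIn (oner_neq0 _).
exists (circle_mesh s), (circle_mesh s').
do 2!(split; first by case: G).
split; first exact: mesh_circle_mesh.
split; first exact: mesh_circle_mesh.
split; first exact: ordinary_circle_mesh.
split; first exact: ordinary_circle_mesh.
split; first by split; exact: convex_circle_mesh.
split=> [i i_def|cong]; first by rewrite !curvature_circle_mesh.
have := @congruent_sqr_area R G _ _ 0 1 2 cong isT isT isT.
rewrite /= !signed_area2_circle_point.
rewrite [X in X ^+ 2 = _](_ : _ = 6 / 5); last by field.
rewrite [X in _ = X ^+ 2](_ : _ = 4 / 5); last by field.
lra.
Qed.
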